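(* Let $F$ be a field, $s\ge 1$, and $\Lambda=M_s(F)$. Let $W=|w_{i,j}|$ be an infinite matrix, with $i,j$ ranging over the positive integers and entries $w_{i,j}\in\Lambda$, such that $w_{i,j}=0$ whenever $i-j\notin\{-1,0,1\}$, and $w_{i+1,j+1}=w_{i,j}$ unless $i=j=1$. Let $G(W)=\sum_{n\ge 0}a_n z^n\in\Lambda[[z]]$, where $a_n$ is the $(1,1)$ entry of $W^n$. Viewing $G(W)$ as an $s\times s$ matrix with entries in $F[[z]]$, every matrix entry of $G(W)$ is algebraic over $F(z)$.
   Context: Since $W$ has only finitely many nonzero diagonals, all powers $W^n$ ($n\ge0$, with $W^0$ the identity) are well defined infinite matrices over $\Lambda$. *)

(* Defs.v *)
From HB Require Import structures.
From mathcomp Require Import all_boot all_order all_algebra.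
From mathcomp Require Import all_classical.
From mathcomp Require Import zify.

Set Implicit Arguments.
Unset Strict Implicit.
Unset Printing Implicit Defensive.

Import Order.TTheory GRing.Theory Num.Theory.
Local Open Scope ring_scope.
Local Open Scope classical_set_scope.

(** * Infinite matrices

    Rows and columns are indexed from 0: the entry written (i, j) with i, j >= 1
    on paper is [W i.-1 j.-1] here. *)

Definition imatrix (R : Type) := nat -> nat -> R.

Definition imx1 (R : pzRingType) : imatrix R := fun i j => (i == j)%:R.

(** The sum over k is the finitely supported sum of [fsbigop]; it is 0 when the
    support is infinite, which cannot happen when each row of [A] has finitely
    many nonzero entries. *)
Definition imx_mul (R : pzRingType) (A B : imatrix R) : imatrix R :=
  fun i j => \sum_(k \in [set: nat]) A i k * B k j.

Definition imx_exp (R : pzRingType) (A : imatrix R) (n : nat) : imatrix R :=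
  iter n (imx_mul A) (@imx1 R).

Definition tridiagonal (R : pzRingType) (W : imatrix R) : Prop :=
  forall i j : nat, i%:Z - j%:Z \notin [:: -1; 0; 1] -> W i j = 0.

Lemma imx_mul_tridiagonal (R : pzRingType) (W B : imatrix R) :
  tridiagonal W ->
  forall i j, imx_mul W B i j = \sum_(k < i.+2) W i k * B k j.
Proof.
move=> hW i j; rewrite /imx_mul (fsbigE (index_iota 0 i.+2)) ?iota_uniq //.
  under eq_bigl do rewrite in_setT.
  by rewrite big_mkord.
move=> k _; rewrite mem_index_iota /= -leqNgt => lik; rewrite hW ?mul0r //.
rewrite !inE; lia.
Qed.

(** * Formal power series *)

Record fps (R : Type) := Fps { coefs : nat -> R }.

Lemma fpsP (R : Type) (f g : fps R) : coefs f =1 coefs g <-> f = g.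
Proof.
by split=> [|->//]; case: f g => [f] [g] /= fg; congr Fps; apply/funext.
Qed.

HB.instance Definition _ (R : Type) := gen_eqMixin (fps R).
HB.instance Definition _ (R : Type) := gen_choiceMixin (fps R).

Section FpsZmodule.
Variable R : zmodType.
Implicit Types f g h : fps R.

Definition fps0 : fps R := Fps (fun=> 0).
Definition fps_opp f : fps R := Fps (fun n => - coefs f n).
Definition fps_add f g : fps R := Fps (fun n => coefs f n + coefs g n).

Fact fps_addA : associative fps_add.
Proof. by move=> f g h; apply/fpsP => n /=; rewrite addrA. Qed.
Fact fps_addC : commutative fps_add.
Proof. by move=> f g; apply/fpsP => n /=; rewrite addrC. Qed.
Fact fps_add0 : left_id fps0 fps_add.
Proof. by move=> f; apply/fpsP => n /=; rewrite add0r. Qed.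
Fact fps_addN : left_inverse fps0 fps_opp fps_add.
Proof. by move=> f; apply/fpsP => n /=; rewrite addNr. Qed.

HB.instance Definition _ :=
  GRing.isZmodule.Build (fps R) fps_addA fps_addC fps_add0 fps_addN.
End FpsZmodule.

Section FpsRing.
Variable R : comNzRingType.
Implicit Types f g h : fps R.

Definition fps1 : fps R := Fps (fun n => (n == 0%N)%:R).
Definition fps_mul f g : fps R :=
  Fps (fun n => \sum_(i < n.+1) coefs f i * coefs g (n - i)%N).

Definition fps_trunc n f : {poly R} := \poly_(i < n.+1) coefs f i.

Lemma coefs_fps_mul n m f g : (m <= n)%N ->
  coefs (fps_mul f g) m = (fps_trunc n f * fps_trunc n g)`_m.
Proof.
move=> mn; rewrite coefM /=; apply: eq_bigr => i _.
by rewrite !coef_poly !ltnS (leq_trans _ mn) ?(leq_trans (leq_subr _ _) mn) // -ltnS.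
Qed.

Fact fps_mulC : commutative fps_mul.
Proof.
by move=> f g; apply/fpsP => n; rewrite !(@coefs_fps_mul n) // mulrC.
Qed.

Fact fps_mulA : associative fps_mul.
Proof.
move=> f g h; apply/fpsP => n.
transitivity ((fps_trunc n f * fps_trunc n g * fps_trunc n h)`_n).
  rewrite -mulrA coefM; apply: eq_bigr => i _; rewrite coef_poly ltn_ord.
  by rewrite (@coefs_fps_mul n) // leq_subr.
rewrite coefM; apply: eq_bigr => i _; rewrite coef_poly ltnS leq_subr.
by rewrite (@coefs_fps_mul n) // -ltnS.
Qed.

Fact fps_mul1 : left_id fps1 fps_mul.
Proof.
move=> f; apply/fpsP => n /=; rewrite big_ord_recl /= mul1r subn0.
by rewrite big1 ?addr0 // => i _; rewrite mul0r.
Qed.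

Fact fps_mulDl : left_distributive fps_mul +%R.
Proof.
move=> f g h; apply/fpsP => n /=; rewrite -big_split.
by apply: eq_bigr => i _; rewrite mulrDl.
Qed.

Fact fps1_neq0 : fps1 != 0.
Proof.
by apply/eqP => /fpsP /(_ 0%N) /= /eqP; rewrite oner_eq0.
Qed.

HB.instance Definition _ := GRing.Zmodule_isComNzRing.Build (fps R)
  fps_mulA fps_mulC fps_mul1 fps_mulDl fps1_neq0.

(** The inverse is chosen classically; the units are the invertible series. *)
Definition fps_unit : pred (fps R) := fun f => `[< exists g, g * f = 1 >].
Definition fps_inv f : fps R := xget f [set g | g * f = 1].

Fact fps_mulV : {in fps_unit, left_inverse 1 fps_inv *%R}.
Proof. by move=> f /asboolP [g gf]; rewrite /fps_inv; case: xgetP => [h _ //|/(_ g)]. Qed.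
Fact fps_unitPl f g : g * f = 1 -> fps_unit f.
Proof. by move=> gf; apply/asboolP; exists g. Qed.
Fact fps_inv_out : {in [predC fps_unit], fps_inv =1 id}.
Proof.
move=> f /asboolPn nf; rewrite /fps_inv; case: xgetP => // h _ hf.
by case: nf; exists h.
Qed.

HB.instance Definition _ :=
  GRing.ComNzRing_hasMulInverse.Build (fps R) fps_mulV fps_unitPl fps_inv_out.

Definition poly_fps (p : {poly R}) : fps R := Fps (fun n => p`_n).

Fact poly_fps_is_zmod_morphism : zmod_morphism poly_fps.
Proof. by move=> p q; apply/fpsP => n /=; rewrite coefB. Qed.
Fact poly_fps_is_monoid_morphism : monoid_morphism poly_fps.
Proof.
split; first by apply/fpsP => n /=; rewrite coef1.
by move=> p q; apply/fpsP => n /=; rewrite coefM.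
Qed.
HB.instance Definition _ := GRing.isZmodMorphism.Build {poly R} (fps R) poly_fps
  poly_fps_is_zmod_morphism.
HB.instance Definition _ := GRing.isMonoidMorphism.Build {poly R} (fps R) poly_fps
  poly_fps_is_monoid_morphism.

Lemma poly_fps_inj : injective poly_fps.
Proof. by move=> p q /fpsP pq; apply/polyP. Qed.

End FpsRing.

Section FpsIdomain.
Variable R : idomainType.

Fact fps_integral : GRing.integral_domain_axiom (fps R).
Proof.
move=> f g fg0; apply/negPn/negP; rewrite negb_or => /andP[f0 g0].
have ex (h : fps R) : h != 0 -> exists n, coefs h n != 0.
  move=> h0; apply: contrapT => nh; case/eqP: h0; apply/fpsP => n /=.
  by apply: contrapT => hn; apply: nh; exists n; apply/eqP.
case: (ex_minnP (ex _ f0)) => m fm mmin; case: (ex_minnP (ex _ g0)) => n gn nmin.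
have /fpsP /(_ (m + n)%N) /= := fg0.
have mlt : (m < (m + n).+1)%N by rewrite ltnS leq_addr.
rewrite (bigD1 (Ordinal mlt)) //= addKn big1 => [|i im].
  by rewrite addr0 => /eqP; rewrite mulf_eq0 (negPf fm) (negPf gn).
have [lti|gei] := ltnP i m.
  have /eqP -> : coefs f i == 0; last by rewrite mul0r.
  by apply: contraLR lti => /mmin; rewrite -leqNgt.
have {}gei : (m < i)%N by rewrite ltn_neqAle gei andbT eq_sym; exact: im.
have /eqP -> : coefs g (m + n - i)%N == 0; last by rewrite mulr0.
have : (m + n - i < n)%N by rewrite ltn_subLR ?ltn_add2r // -ltnS ltn_ord.
by apply: contraLR => /nmin; rewrite -leqNgt.
Qed.

HB.instance Definition _ := GRing.ComUnitRing_isIntegral.Build (fps R) fps_integral.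
End FpsIdomain.

(** The entrywise view of R^(m x n)[[z]] as R[[z]]^(m x n). *)
Definition fps_mx (R : Type) (m n : nat) (A : fps 'M[R]_(m, n)) : 'M[fps R]_(m, n) :=
  \matrix_(i, j) Fps (fun k => coefs A k i j).

(** * F(z) inside F((z)) = Frac F[[z]] *)

Section RatLaurent.
Variable F : fieldType.
Local Notation tofrac := (@FracField.tofrac _).
Local Notation K := {fraction {poly F}}.
Local Notation L := {fraction (fps F)}.

(** The expansion n/d |-> n/d, computed on a chosen representative; it does not
    depend on that choice ([ratfun_laurent_div]). *)
Definition ratfun_laurent (x : K) : L :=
  let r := repr x in
  tofrac (poly_fps \n_r) / tofrac (poly_fps \d_r).

Lemma fracE (x : K) :
  x = tofrac \n_(repr x) / tofrac \d_(repr x).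
Proof.
set r := repr x.
have r0 : \d_r != 0 by exact: denom_ratioP.
rewrite -[LHS]reprK -/r.
unlock FracField.tofrac; rewrite -[_^-1]FracField.pi_inv -[RHS]FracField.pi_mul.
congr generic_quotient.pi; rewrite /FracField.mulf /FracField.invf.
by rewrite !(numden_Ratio, mulr1, mul1r) ?oner_neq0 // Ratio_numden.
Qed.

Lemma poly_fps_eq0 (p : {poly F}) : (poly_fps p == 0) = (p == 0).
Proof. by rewrite -(rmorph0 (@poly_fps F)) (inj_eq (@poly_fps_inj F)). Qed.

Lemma ratfun_laurent_div (n d : {poly F}) : d != 0 ->
  ratfun_laurent (tofrac n / tofrac d) =
  tofrac (poly_fps n) / tofrac (poly_fps d).
Proof.
move=> d0; rewrite /ratfun_laurent.
set x := tofrac n / tofrac d; set r := repr x.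
have r0 : \d_r != 0 by exact: denom_ratioP.
have /eqP := fracE x; rewrite -/r /x.
rewrite eqr_div ?tofrac_eq0 // -!tofracM tofrac_eq => /eqP nd.
apply/eqP; rewrite eqr_div ?tofrac_eq0 ?poly_fps_eq0 //.
by rewrite -!tofracM -!rmorphM nd.
Qed.

Fact ratfun_laurent_is_zmod_morphism : zmod_morphism ratfun_laurent.
Proof.
move=> x y; rewrite {1}(fracE x) {1}(fracE y) -mulNr -tofracN.
set r := repr x; set q := repr y.
have r0 : \d_r != 0 by exact: denom_ratioP.
have q0 : \d_q != 0 by exact: denom_ratioP.
rewrite addf_div ?tofrac_eq0 // -!tofracM -tofracD ratfun_laurent_div ?mulf_neq0 //.
rewrite /ratfun_laurent -/r -/q -mulNr -tofracN.
rewrite addf_div ?tofrac_eq0 ?poly_fps_eq0 // -!tofracM -tofracD.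
by congr (tofrac _ / tofrac _); rewrite !(rmorphD, rmorphM, rmorphN).
Qed.

Fact ratfun_laurent_is_monoid_morphism : monoid_morphism ratfun_laurent.
Proof.
split.
  rewrite -[1]divr1 -{1 2}tofrac1 ratfun_laurent_div ?oner_neq0 //.
  by rewrite rmorph1 tofrac1 divr1.
move=> x y; rewrite {1}(fracE x) {1}(fracE y).
set r := repr x; set q := repr y.
have r0 : \d_r != 0 by exact: denom_ratioP.
have q0 : \d_q != 0 by exact: denom_ratioP.
rewrite mulf_div -!tofracM ratfun_laurent_div ?mulf_neq0 //.
by rewrite /ratfun_laurent -/r -/q mulf_div -!tofracM -!rmorphM.
Qed.

HB.instance Definition _ :=
  GRing.isZmodMorphism.Build K L ratfun_laurent ratfun_laurent_is_zmod_morphism.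
HB.instance Definition _ :=
  GRing.isMonoidMorphism.Build K L ratfun_laurent ratfun_laurent_is_monoid_morphism.

End RatLaurent.

(** f in F[[z]] is algebraic over F(z), both viewed in F((z)). *)
Definition fps_algebraic (F : fieldType) (f : fps F) : Prop :=
  algebraicOver (@ratfun_laurent F) (FracField.tofrac f).

(** G(W), the generating series of the top left entries of the powers of W. *)
Definition gen_series (R : pzRingType) (W : imatrix R) : fps R :=
  Fps (fun n => imx_exp W n 0%N 0%N).

(* Main.v *)
Require Import Defs.
From HB Require Import structures.
From mathcomp Require Import all_boot all_order all_algebra fieldext.
From mathcomp Require Import boolp ring zify.

(** Write A, B, C for the entries just above, on and just below the diagonal of
    the Toeplitz part of W, and D for the corner entry. The series H_i of the
    (i, 0) entries of the powers of W satisfy H_(i+1) = R H_i, where R is the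
    solution of R = z (C + B R + A R^2) over F[[z]], so that
    G(W) = (1 - z D - z A R)^-1 and it suffices to show that R is algebraic.

    The transpose U of R is a root of a quadratic equation whose leading
    coefficient need not be invertible, but T = (U - 1)^-1 satisfies a monic one,
    T^2 = m1 + T m2. The row space of [1 T] is invariant under the companion
    matrix M = [0 m1; 1 m2], which acts on it as T and on the quotient as
    m2 - T. Modulo z these are -1 and 0, so they have no common eigenvalue, and
    the row space of [1 T] is the left kernel of chi(M), chi being the minimal
    polynomial of T. Since chi divides the characteristic polynomial of M, its
    coefficients are algebraic over F(z), hence so is that kernel, and T can be
    read off from it. *)

Set Implicit Arguments.
Unset Strict Implicit.
Unset Printing Implicit Defensive.

Import Order.TTheory GRing.Theory Num.Theory.
Local Open Scope ring_scope.

(** * Splitting fields and descent of polynomial factors *)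

Lemma ex_irreducible_dvdp (L : fieldType) (p : {poly L}) :
  (1 < size p)%N -> exists2 q, irreducible_poly q & q %| p.
Proof.
elim/ltn_ind: {p}(size p) {-2}p (erefl (size p)) => n IH p szp sp.
have [[q [sq qp neq]]|nq] :=
    pselect (exists q : {poly L}, [/\ size q != 1%N, q %| p & ~~ (q %= p)]); last first.
  exists p => //; split=> // q sq qp; apply: contrapT => /negP neq.
  by apply: nq; exists q.
have p0 : p != 0 by rewrite -size_poly_gt0 ltnW.
have q0 : q != 0 by apply: contraTneq qp => ->; rewrite dvd0p.
have ltq : (size q < n)%N.
  rewrite -szp ltn_neqAle dvdp_leq // andbT.
  by apply: contra neq; rewrite -dvdp_size_eqp.
have sq1 : (1 < size q)%N by rewrite ltn_neqAle eq_sym sq size_poly_gt0.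
have [r irr_r rq] := IH _ ltq q erefl sq1.
by exists r => //; apply: dvdp_trans rq qp.
Qed.

(** A root of an irreducible factor is adjoined and divided out, by induction on the degree. *)
Lemma ex_splitting_field (L : fieldType) (p : {poly L}) : p \is monic ->
  exists (M : fieldType) (j : {rmorphism L -> M}) (rs : seq M),
    map_poly j p = \prod_(r <- rs) ('X - r%:P).
Proof.
have [n] := ubnPleq (size p); elim: n => [|n IH] in L p * => szp mp.
  by move: szp; rewrite leqn0 size_poly_eq0 (negPf (monic_neq0 mp)).
have [sp1|sp1] := leqP (size p) 1.
  have p1 : p = 1.
    by move: mp; rewrite (size1_polyC sp1) => /monicP; rewrite lead_coefC => ->.
  by exists L, idfun, [::]; rewrite p1 rmorph1 big_nil.
have [q irr_q qp] := ex_irreducible_dvdp sp1.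
have [K _ [x qx0 _]] := irredp_FAdjoin irr_q.
have px0 : root (map_poly (in_alg K) p) x.
  by apply: root_dvdp qx0; rewrite dvdp_map.
have /factor_theorem [p' pE] := px0.
have mp' : p' \is monic.
  by rewrite -(monicMr _ (monicXsubC x)) -pE map_monic.
have szp' : (size p' <= n)%N.
  have := size_map_poly (in_alg K) p; rewrite pE size_Mmonic ?monicXsubC ?monic_neq0 //.
  by rewrite size_XsubC addn2 /= => e; rewrite -ltnS e.
have [M [j [rs jE]]] := IH K p' szp' mp'.
exists M, (j \o in_alg K), (j x :: rs).
rewrite big_cons map_poly_comp /= pE rmorphM /= jE mulrC.
by rewrite rmorphB /= map_polyX map_polyC.
Qed.

Lemma integral_prod_XsubC (R K : comNzRingType) (f : {rmorphism R -> K}) (rs : seq K) :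
  (forall r, r \in rs -> integralOver f r) ->
  forall i, integralOver f (\prod_(r <- rs) ('X - r%:P))`_i.
Proof.
elim: rs => [|r rs IH] intr i.
  by rewrite big_nil coef1; apply: integral_nat.
have {}IH k : integralOver f (\prod_(r <- rs) ('X - r%:P))`_k.
  by apply: IH => y ys; apply: intr; rewrite inE ys orbT.
rewrite big_cons mulrBl coefB coefXM coefCM; apply: integral_sub.
  by case: ifP => _; [apply: integral0 | apply: IH].
by apply: integral_mul => //; apply: intr; rewrite mem_head.
Qed.

Definition algebraically_closed_in (E L : fieldType) (f : E -> L) :=
  forall x, algebraicOver f x -> exists y, f y = x.

(** In a splitting field of [p] the roots of [p] are roots of [q], hence integral over [E]. So are
    the coefficients of [p], and these lie in [L], where [E] is algebraically closed. *)
Lemma dvdp_descent (E L : fieldType) (f : {rmorphism E -> L}) (p : {poly L})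
    (q : {poly E}) :
  algebraically_closed_in f -> p \is monic -> q != 0 -> p %| map_poly f q ->
  exists p0, map_poly f p0 = p.
Proof.
move=> clf mp q0 pq; have [M [j [rs jE]]] := ex_splitting_field mp.
have intr r : r \in rs -> integralOver (j \o f) r.
  move=> rrs; apply/integral_algebraic; exists q => //.
  rewrite map_poly_comp; apply: (@root_dvdp _ (map_poly j p)).
    by rewrite dvdp_map.
  by rewrite jE root_prod_XsubC.
have /choice [c cE] : forall i, exists y, f y = p`_i.
  move=> i; apply: clf.
  have /integral_algebraic [g g0 gr] : integralOver (j \o f) (j p`_i).
    by rewrite -coef_map jE; apply: integral_prod_XsubC.
  by exists g => //; move: gr; rewrite map_poly_comp fmorph_root.
exists (\poly_(i < size p) c i); apply/polyP => i.
rewrite coef_map coef_poly; case: ltnP => [_|ge] /=; first exact: cE.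
by rewrite rmorph0 nth_default.
Qed.

(** * Descent of solutions of a monic quadratic matrix equation *)

Lemma horner_mx_intertwine (R : comNzRingType) (m n : nat) (A : 'M[R]_m.+1)
    (B : 'M[R]_n.+1) (X : 'M[R]_(m.+1, n.+1)) (p : {poly R}) :
  A *m X = X *m B -> horner_mx A p *m X = X *m horner_mx B p.
Proof.
move=> AX; elim/poly_ind: p => [|p c IH]; first by rewrite !rmorph0 mul0mx mulmx0.
rewrite !rmorphD !rmorphM /= !horner_mx_X !horner_mx_C mulmxDl mulmxDr.
by rewrite -!mulmxE -mulmxA AX mulmxA IH mulmxA scalar_mxC.
Qed.

Lemma quadratic_solution_descent (E L : fieldType) (f : {rmorphism E -> L}) (n : nat)
    (m1 m2 : 'M[E]_n.+1) (T : 'M[L]_n.+1) :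
  algebraically_closed_in f ->
  T *m T = map_mx f m1 + T *m map_mx f m2 ->
  horner_mx (map_mx f m2 - T) (char_poly T) \in unitmx ->
  exists T0, T = map_mx f T0.
Proof.
move=> clf TE unitS; set S := map_mx f m2 - T in unitS.
pose M : 'M[E]_(n.+1 + n.+1) := block_mx 0 m1 1%:M m2.
pose MF : 'M[L]_(n.+1 + n.+1) := map_mx f M.
have ME : MF = block_mx 0 (map_mx f m1) 1%:M (map_mx f m2).
  by rewrite /MF map_block_mx map_mx0 map_mx1.
have TM : T *m row_mx 1%:M T = row_mx 1%:M T *m MF.
  by rewrite ME mul_row_block mul_mx_row mulmx1 mulmx0 add0r !mul1mx TE.
(* The left kernel of this column is the row space of [[1 T]], so multiplying by it is the quotient
   map, on whose target [M] acts as [S]. *)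
have MS : MF *m col_mx (- T) 1%:M = col_mx (- T) 1%:M *m S.
  rewrite ME mul_block_col mul_col_mx mul0mx add0r !mul1mx !mulmx1.
  congr col_mx; last by rewrite addrC.
  by rewrite mulNmx /S mulmxBr TE opprB addrK.
have TF p : horner_mx T p *m row_mx 1%:M T = row_mx 1%:M T *m horner_mx MF p.
  exact: horner_mx_intertwine.
(* Cayley-Hamilton for [M], carried over by [TF], shows that [char_poly M], whose coefficients are
   in [E], annihilates [T]. *)
have [p0 pE] : exists p0, map_poly f p0 = mxminpoly T.
  apply: (dvdp_descent (q := char_poly M) clf (mxminpoly_monic T)).
    exact/monic_neq0/char_poly_monic.
  apply: mxminpoly_min; have := TF (map_poly f (char_poly M)).
  rewrite map_char_poly Cayley_Hamilton mulmx0 mul_mx_row mulmx1 => /eqP.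
  by rewrite row_mx_eq0 => /andP[/eqP].
have unitp : horner_mx S (mxminpoly T) \in unitmx.
  have /dvdpP [q qE] := mxminpoly_dvd_char T.
  by move: unitS; rewrite qE rmorphM /= -mulmxE unitmx_mul => /andP[].
pose X : 'M[E]_(n.+1 + n.+1) := horner_mx M p0; pose K := kermx X.
have XF : map_mx f X = horner_mx MF (mxminpoly T).
  by rewrite /X map_horner_mx pE.
pose K1 := lsubmx K; pose K2 := rsubmx K.
have KE : K = row_mx K1 K2 by rewrite hsubmxK.
(* For a row [[k1 k2]] killed by chi(M), the quotient map gives [(k2 - k1 T) chi(S) = 0], and chi(S)
   is invertible. *)
have K12 : map_mx f K2 = map_mx f K1 *m T.
  have : map_mx f K *m map_mx f X *m col_mx (- T) 1%:M = 0.
    by rewrite -map_mxM mulmx_ker map_mx0 mul0mx.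
  rewrite XF -mulmxA (horner_mx_intertwine (mxminpoly T) MS) mulmxA.
  move/(congr1 (mulmx^~ (invmx (horner_mx S (mxminpoly T))))).
  rewrite mulmxK // mul0mx KE map_row_mx mul_row_col mulmx1 mulmxN.
  by move/eqP; rewrite addrC subr_eq0 => /eqP.
(* Conversely, chi(T) = 0 puts [[1 T]] in the kernel. Hence [K1] has full column rank, and a left
   inverse [J] over [E] yields [T = J K2]. *)
have : (row_mx 1%:M T <= map_mx f K)%MS.
  rewrite /K map_kermx XF; apply/sub_kermxP.
  by rewrite -TF mx_root_minpoly mul0mx.
case/submxP => D; rewrite KE map_row_mx mul_mx_row => /eq_row_mx [D1 _].
have : row_full K1.
  rewrite -(row_full_map f) -sub1mx D1; exact: submxMl.
move/row_fullP => [J JK]; exists (J *m K2).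
by rewrite map_mxM K12 mulmxA -map_mxM JK map_mx1 mul1mx.
Qed.

(** * The algebraic closure of one field inside another *)

Section RelativeAlgebraicClosure.
Variables (K L : fieldType) (f : {rmorphism K -> L}).

Definition algebraic_over : {pred L} := fun x => `[< algebraicOver f x >].

Fact algebraic_over_divring_closed : divring_closed algebraic_over.
Proof.
split; first exact/asboolP/algebraic1.
  by move=> x y /asboolP ax /asboolP ay; apply/asboolP/algebraic_sub.
by move=> x y /asboolP ax /asboolP ay; apply/asboolP/algebraic_div.
Qed.

Record rel_alg_closure :=
  RelAlgClosure { rac_val : L; _ : rac_val \in algebraic_over }.

HB.instance Definition _ := [isSub for rac_val].
HB.instance Definition _ := [Choice of rel_alg_closure by <:].
HB.instance Definition _ := GRing.SubChoice_isSubIntegralDomain.Build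
  L algebraic_over rel_alg_closure algebraic_over_divring_closed.
HB.instance Definition _ := [SubIntegralDomain_isSubField of rel_alg_closure by <:].

Lemma rel_alg_closureP (x : L) :
  algebraicOver f x <-> exists y : rel_alg_closure, \val y = x.
Proof.
split=> [/asboolP ax|[[y ay] <-]]; last exact/asboolP.
by exists (RelAlgClosure ax).
Qed.

(** Transitivity of integrality: [x] is a root of a polynomial whose coefficients are integral over
    [K]. *)
Lemma rel_alg_closure_closed :
  algebraically_closed_in (val : rel_alg_closure -> L).
Proof.
move=> x [p p0 px]; apply/rel_alg_closureP/integral_algebraic.
apply: (integral_root (p := map_poly val p)) px _; first by rewrite map_poly_eq0.
apply/integral_poly => i; rewrite coef_map /=.
by apply/integral_algebraic/rel_alg_closureP; exists p`_i.
Qed.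

End RelativeAlgebraicClosure.

(** * Coefficients and fixed points for matrices of power series *)

Section SeriesMatrices.
Variable F : fieldType.
Implicit Types m n p q : nat.

Definition coefmx l m n (X : 'M[fps F]_(m, n)) : 'M[F]_(m, n) :=
  map_mx (fun f => coefs f l) X.

Lemma coefmxD l m n (X Y : 'M[fps F]_(m, n)) :
  coefmx l (X + Y) = coefmx l X + coefmx l Y.
Proof. by apply/matrixP => i j; rewrite !mxE. Qed.

Lemma coefs_sum (I : Type) (r : seq I) (P : pred I) (G : I -> fps F) l :
  coefs (\sum_(i <- r | P i) G i) l = \sum_(i <- r | P i) coefs (G i) l.
Proof.
by elim/big_rec2: _ => //= i x y _ <-.
Qed.

Lemma coefmxM l m n p (X : 'M[fps F]_(m, n)) (Y : 'M_(n, p)) :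
  coefmx l (X *m Y) = \sum_(a < l.+1) coefmx a X *m coefmx (l - a) Y.
Proof.
apply/matrixP => i j; rewrite !mxE coefs_sum summxE /= exchange_big /=.
by apply: eq_bigr => a _; rewrite mxE; apply: eq_bigr => k _; rewrite !mxE.
Qed.

Lemma coefmx_inj m n (X Y : 'M[fps F]_(m, n)) :
  (forall l, coefmx l X = coefmx l Y) -> X = Y.
Proof.
move=> XY; apply/matrixP => i j; apply/fpsP => l.
by have /matrixP /(_ i j) := XY l; rewrite !mxE.
Qed.

Definition fpsX : fps F := poly_fps 'X.

Lemma coefs_fpsX0 (g : fps F) : coefs (fpsX * g) 0 = 0.
Proof. by rewrite /= big_ord_recl big_ord0 /= coefX mul0r addr0. Qed.

Lemma coefs_fpsXS (g : fps F) l : coefs (fpsX * g) l.+1 = coefs g l.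
Proof.
rewrite /= big_ord_recl /= coefX mul0r add0r big_ord_recl /= coefX mul1r.
by rewrite big1 => [|i _]; rewrite ?coefX ?mul0r // addr0 subSS subn0.
Qed.

Lemma coefmxX0 m n (X : 'M[fps F]_(m, n)) : coefmx 0 (fpsX *: X) = 0.
Proof. by apply/matrixP => i j; rewrite !mxE coefs_fpsX0. Qed.

Lemma coefmxXS l m n (X : 'M[fps F]_(m, n)) :
  coefmx l.+1 (fpsX *: X) = coefmx l X.
Proof. by apply/matrixP => i j; rewrite !mxE coefs_fpsXS. Qed.

Definition cmx m n (A : 'M[F]_(m, n)) : 'M[fps F]_(m, n) :=
  map_mx (@poly_fps F \o polyC) A.

Lemma coefmx_cmx l m n (A : 'M[F]_(m, n)) :
  coefmx l (cmx A) = if l == 0%N then A else 0.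
Proof.
by apply/matrixP => i j; rewrite !mxE /= coefC; case: eqP => _; rewrite ?mxE.
Qed.

Lemma coefmxCM l m n p (A : 'M[F]_(m, n)) (X : 'M[fps F]_(n, p)) :
  coefmx l (cmx A *m X) = A *m coefmx l X.
Proof.
rewrite coefmxM big_ord_recl coefmx_cmx /= subn0 big1 ?addr0 // => i _.
by rewrite coefmx_cmx /= mul0mx.
Qed.

(** Nonexpansive for the z-adic distance. *)
Definition nonexpansive m n p q (P : 'M[fps F]_(m, n) -> 'M[fps F]_(p, q)) :=
  forall l X Y, (forall a, (a <= l)%N -> coefmx a X = coefmx a Y) ->
  coefmx l (P X) = coefmx l (P Y).

Lemma nonexpansive_id m n : nonexpansive (fun X : 'M[fps F]_(m, n) => X).
Proof. by move=> l X Y; apply. Qed.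

Lemma nonexpansive_cst m n p q (C : 'M[fps F]_(p, q)) :
  nonexpansive (fun X : 'M[fps F]_(m, n) => C).
Proof. by []. Qed.

Lemma nonexpansiveD m n p q (P Q : 'M[fps F]_(m, n) -> 'M[fps F]_(p, q)) :
  nonexpansive P -> nonexpansive Q -> nonexpansive (fun X => P X + Q X).
Proof. by move=> nP nQ l X Y XY; rewrite !coefmxD (nP _ X Y) ?(nQ _ X Y). Qed.

Lemma nonexpansiveM m n p q r (P : 'M[fps F]_(m, n) -> 'M[fps F]_(p, q))
    (Q : 'M[fps F]_(m, n) -> 'M[fps F]_(q, r)) :
  nonexpansive P -> nonexpansive Q -> nonexpansive (fun X => P X *m Q X).
Proof.
move=> nP nQ l X Y XY; rewrite !coefmxM; apply: eq_bigr => a _.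
by congr (_ *m _); [apply: nP | apply: nQ] => b ba; apply: XY;
  apply: leq_trans ba _; rewrite ?leq_subr // -ltnS.
Qed.

(** The factor z makes [X |-> C + z P X] a z-adic contraction, so its iterates converge
    coefficientwise. *)
Lemma nonexpansive_fixpoint m n (C : 'M[fps F]_(m, n))
    (P : 'M[fps F]_(m, n) -> 'M[fps F]_(m, n)) :
  nonexpansive P -> exists X, X = C + fpsX *: P X.
Proof.
move=> nP; pose Phi X := C + fpsX *: P X; suff: exists X, X = Phi X by [].
have Phi0 X : coefmx 0 (Phi X) = coefmx 0 C by rewrite coefmxD coefmxX0 addr0.
have PhiE l X : coefmx l.+1 (Phi X) = coefmx l.+1 C + coefmx l (P X).
  by rewrite coefmxD coefmxXS.
clearbody Phi.
have PhiS l X Y : coefmx l (P X) = coefmx l (P Y) ->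
    coefmx l.+1 (Phi X) = coefmx l.+1 (Phi Y).
  by rewrite !PhiE => ->.
pose r k := iter k Phi 0; have rE k : r k.+1 = Phi (r k) by [].
clearbody r.
have rS k : forall l, (l < k)%N -> coefmx l (r k.+1) = coefmx l (r k).
  elim: k => // k IH [|l] lk; first by rewrite [r k.+2]rE [r k.+1]rE !Phi0.
  rewrite [r k.+2]rE [r k.+1 in RHS]rE; apply/PhiS/nP => a al.
  exact/IH/(leq_ltn_trans al).
have rlt l k : (l < k)%N -> coefmx l (r k) = coefmx l (r l.+1).
  elim: k => // k IH; rewrite ltnS leq_eqVlt => /predU1P[-> //|lk].
  by rewrite rS // IH.
(* The limit is diagonal: coefficient [l] is already final in iterate [l.+1]. *)
have [X XE] : exists X, forall l, coefmx l X = coefmx l (r l.+1).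
  exists (\matrix_(i, j) Fps (fun l => coefs (r l.+1 i j) l)) => l.
  by apply/matrixP => i j; rewrite !mxE.
exists X; apply: coefmx_inj => -[|l]; rewrite XE rE.
  by rewrite !Phi0.
by apply/PhiS/nP => a al; rewrite XE rlt.
Qed.

(** The geometric series, obtained as the solution of [X = 1 + z N X]. *)
Lemma unitmx_1BfpsX n (N : 'M[fps F]_n) :
  exists X, (1%:M - fpsX *: N) *m X = 1%:M.
Proof.
have [X XE] := nonexpansive_fixpoint 1%:M
  (nonexpansiveM (@nonexpansive_cst n n _ _ N) (@nonexpansive_id n n)).
by exists X; rewrite mulmxBl mul1mx -scalemxAl {1}XE addrK.
Qed.

(** * Matrices of series algebraic over F(z) *)

Local Notation L := {fraction (fps F)}.
Local Notation tofrac := (@FracField.tofrac (fps F)).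
Local Notation E := (rel_alg_closure (@ratfun_laurent F)).

(** Stated as a lift to matrices over the field [E], so that closure under matrix operations follows
    by performing them over [E]. *)
Definition mx_algebraic m n (X : 'M[fps F]_(m, n)) :=
  exists X0 : 'M[E]_(m, n), map_mx val X0 = map_mx tofrac X.

Lemma mx_algebraicP m n (X : 'M[fps F]_(m, n)) :
  mx_algebraic X <-> forall i j, fps_algebraic (X i j).
Proof.
split=> [[X0 X0E] i j|algX].
  apply/rel_alg_closureP; exists (X0 i j).
  by have /matrixP /(_ i j) := X0E; rewrite !mxE.
have /choice [c cE] : forall ij, exists y : E, \val y = tofrac (X ij.1 ij.2).
  by move=> ij; apply/rel_alg_closureP/algX.
by exists (\matrix_(i, j) c (i, j)); apply/matrixP => i j; rewrite !mxE cE.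
Qed.

Lemma mx_algebraicD m n (X Y : 'M[fps F]_(m, n)) :
  mx_algebraic X -> mx_algebraic Y -> mx_algebraic (X + Y).
Proof. by move=> [X0 XE] [Y0 YE]; exists (X0 + Y0); rewrite !map_mxD XE YE. Qed.

Lemma mx_algebraicN m n (X : 'M[fps F]_(m, n)) :
  mx_algebraic X -> mx_algebraic (- X).
Proof. by move=> [X0 XE]; exists (- X0); rewrite !map_mxN XE. Qed.

Lemma mx_algebraicM m n p (X : 'M[fps F]_(m, n)) (Y : 'M[fps F]_(n, p)) :
  mx_algebraic X -> mx_algebraic Y -> mx_algebraic (X *m Y).
Proof. by move=> [X0 XE] [Y0 YE]; exists (X0 *m Y0); rewrite !map_mxM XE YE. Qed.

Lemma mx_algebraic1 n : mx_algebraic (1%:M : 'M_n).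
Proof. by exists 1%:M; rewrite !map_mx1. Qed.

Lemma mx_algebraic_tr m n (X : 'M[fps F]_(m, n)) :
  mx_algebraic X -> mx_algebraic X^T.
Proof. by move=> [X0 XE]; exists X0^T; rewrite -!map_trmx XE. Qed.

Lemma mx_algebraic_poly m n (A : 'M[{poly F}]_(m, n)) :
  mx_algebraic (map_mx (@poly_fps F) A).
Proof.
apply/mx_algebraicP => i j; rewrite mxE /fps_algebraic.
have -> : tofrac (poly_fps (A i j)) = ratfun_laurent (FracField.tofrac (A i j)).
  rewrite -[FracField.tofrac (A i j)]divr1 -[1]tofrac1 ratfun_laurent_div ?oner_neq0 //.
  by rewrite rmorph1 tofrac1 divr1.
exact: algebraic_id.
Qed.

Lemma mx_algebraicX m n (X : 'M[fps F]_(m, n)) :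
  mx_algebraic X -> mx_algebraic (fpsX *: X).
Proof.
rewrite -mul_scalar_mx; apply: mx_algebraicM.
by rewrite -map_scalar_mx; apply: mx_algebraic_poly.
Qed.

Lemma mx_algebraic_cmx m n (A : 'M[F]_(m, n)) : mx_algebraic (cmx A).
Proof. by rewrite /cmx map_mx_comp; apply: mx_algebraic_poly. Qed.

(** The inverse can be computed over [E], by uniqueness of inverses over F((z)). *)
Lemma mx_algebraicV n (X Y : 'M[fps F]_n) :
  X *m Y = 1%:M -> mx_algebraic X -> mx_algebraic Y.
Proof.
move=> XY [X0 XE]; exists (invmx X0).
have XYL : map_mx tofrac X *m map_mx tofrac Y = 1%:M by rewrite -map_mxM XY map_mx1.
have [uX _] := mulmx1_unit XYL.
by rewrite map_invmx XE -[LHS]mulmx1 -XYL mulKmx.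
Qed.

End SeriesMatrices.

(** * Algebraicity of the solution of the quadratic matrix equation *)

Section QuadraticEquation.
Variables (F : fieldType) (n : nat).
Local Notation Z := (fpsX F).
Local Notation tofrac := (@FracField.tofrac (fps F)).

(** Reduction modulo z, made a ring morphism so that it commutes with determinants and
    characteristic polynomials. *)
Definition fps_eval0 (g : fps F) : F := coefs g 0.

Fact fps_eval0_is_zmod_morphism : zmod_morphism fps_eval0.
Proof. by []. Qed.

Fact fps_eval0_is_monoid_morphism : monoid_morphism fps_eval0.
Proof. by split=> // f g; rewrite /fps_eval0 /= big_ord_recl big_ord0 addr0. Qed.

HB.instance Definition _ := GRing.isZmodMorphism.Build (fps F) F fps_eval0
  fps_eval0_is_zmod_morphism.
HB.instance Definition _ := GRing.isMonoidMorphism.Build (fps F) F fps_eval0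
  fps_eval0_is_monoid_morphism.

Lemma map_fps_eval0 (X : 'M[fps F]_n.+1) : map_mx fps_eval0 X = coefmx 0 X.
Proof. by []. Qed.

Lemma horner_mx0 (R : comNzRingType) (p : {poly R}) :
  horner_mx (0 : 'M[R]_n.+1) p = (p.[0])%:M.
Proof.
elim/poly_ind: p => [|p c _]; first by rewrite rmorph0 horner0 raddf0.
by rewrite rmorphD rmorphM /= horner_mx_X horner_mx_C -mulmxE mulmx0 add0r hornerMXaddC mulr0 add0r.
Qed.

Lemma unitmx_eval0 (X : 'M[fps F]_n.+1) :
  map_mx fps_eval0 X \in unitmx -> map_mx tofrac X \in unitmx.
Proof.
rewrite !unitmxE !unitfE !det_map_mx; apply: contra.
by rewrite tofrac_eq0 => /eqP ->; rewrite rmorph0.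
Qed.

Lemma mx_algebraic_quadratic (T m1 m2 : 'M[fps F]_n.+1) :
  mx_algebraic m1 -> mx_algebraic m2 -> T *m T = m1 + T *m m2 ->
  coefmx 0 T = (- 1)%:M -> coefmx 0 m2 = (- 1)%:M -> mx_algebraic T.
Proof.
move=> [x1 x1E] [x2 x2E] TE T0 m20.
have [||T1 T1E] := quadratic_solution_descent (f := \val) (m1 := x1) (m2 := x2)
    (T := map_mx tofrac T) (@rel_alg_closure_closed _ _ _).
- by rewrite x1E x2E -!map_mxM TE map_mxD.
(* Modulo z, [m2 - T] vanishes, so only the constant coefficient of [char_poly T] remains. Up to
   sign it is the determinant of -1, a unit. *)
- rewrite x2E -map_mxB -map_char_poly -map_horner_mx; apply: unitmx_eval0.
  rewrite map_horner_mx map_char_poly map_mxB !map_fps_eval0 T0 m20 subrr.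
  rewrite horner_mx0 horner_coef0 char_poly_det det_scalar unitmxE det_scalar.
  by rewrite unitrX // unitrMl unitrX ?unitrN1.
by exists T1.
Qed.

(** Each letter string stands for a product, such as [tta] for [T T a]. With the products as atoms,
    the noncommutative computation becomes additive and can be checked entrywise by [ring]. *)
Lemma linear_identity (R : comPzRingType) (p q : nat)
    (t tt tta ttb ttc tb tc c : 'M[R]_(p, q)) :
  t + tt = tta + (tb + ttb) + (c + tc + tc + ttc) ->
  tt - (tta + ttb + ttc) = c + (tb + tc + tc - t).
Proof.
move=> h; apply/matrixP => i j; move/matrixP/(_ i j): h; rewrite !mxE => h.
have -> : tt i j = (t i j + tt i j) - t i j by ring.
rewrite h; ring.
Qed.

(** Put [a = z A], [b = z B], [c = z C] and [U = 1 + T^-1]. Multiplying [U = a + U b + U^2 c] on the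
    left by [T^2] gives [T^2 (1 - a - b - c) = c + T (b + 2 c - 1)], where [1 - a - b - c] is
    invertible. *)
Lemma ex_algebraic_quadratic_fixpoint (A B C : 'M[F]_n.+1) :
  exists2 U : 'M[fps F]_n.+1,
    U = Z *: (cmx A + U *m cmx B + U *m U *m cmx C) & mx_algebraic U.
Proof.
have [U] := nonexpansive_fixpoint 0 (nonexpansiveD (nonexpansiveD
  (nonexpansive_cst (cmx A)) (nonexpansiveM (@nonexpansive_id F n.+1 n.+1)
    (nonexpansive_cst (cmx B))))
  (nonexpansiveM (nonexpansiveM (@nonexpansive_id F n.+1 n.+1)
    (@nonexpansive_id F n.+1 n.+1)) (nonexpansive_cst (cmx C)))).
rewrite add0r; set Y := (cmx A + _ + _) => UE; exists U => //.
(* [V] inverts the leading coefficient of the equation for [T], which makes that equation monic. *)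
have [V VE] := unitmx_1BfpsX (cmx A + cmx B + cmx C).
have [T' T'E] := unitmx_1BfpsX Y; rewrite -UE in T'E.
pose T := - T'.
have T'U : T' *m (1%:M - U) = 1%:M by apply: mulmx1C.
have TU : T *m U = 1%:M + T.
  by move: T'U; rewrite /T mulmxBr mulmx1 mulNmx => <-; rewrite addrAC subrr add0r.
have T0 : coefmx 0 T = (- 1)%:M.
  (* This is [T = U T - 1], with [U] divisible by z. *)
  have -> : T = Z *: (Y *m T) - 1%:M.
    rewrite scalemxAl -UE /T mulmxN; move: T'E; rewrite mulmxBl mul1mx => <-.
    by rewrite opprB addKr.
  rewrite -map_fps_eval0 map_mxB map_fps_eval0 coefmxX0 map_mx1 sub0r.
  by rewrite -[RHS]scalemx1 scaleN1r.
pose a := Z *: cmx A; pose b := Z *: cmx B; pose c := Z *: cmx C.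
have NE : Z *: (cmx A + cmx B + cmx C) = a + b + c.
  by rewrite scalerDr [Z *: (cmx A + cmx B)]scalerDr.
have UE' : U = a + U *m b + U *m U *m c.
  by rewrite {1}UE /Y scalerDr [Z *: (cmx A + _)]scalerDr !scalemxAr.
have TT : T *m T = (c + T *m (b + c + c - 1%:M)) *m V.
  rewrite -[LHS]mulmx1 -[in LHS]VE mulmxA; congr (_ *m _).
  rewrite NE; clear - TU UE'; clearbody a b c T.
  rewrite !mulmxBr !mulmx1 !mulmxDr.
  have TTU : T *m T *m U = T + T *m T by rewrite -mulmxA TU mulmxDr mulmx1.
  have TTUU : T *m T *m U *m U = 1%:M + T + T + T *m T.
    by rewrite TTU mulmxDl TTU TU !addrA.
  have h : T + T *m T = T *m T *m a + (T *m b + T *m T *m b) +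
      (c + T *m c + T *m c + T *m T *m c).
    rewrite -{1}TTU {1}UE' !mulmxDr !(mulmxA (T *m T)) TTUU TTU.
    by rewrite !mulmxDl mul1mx.
  exact: linear_identity.
have V0 : coefmx 0 V = 1%:M.
  have -> : V = 1%:M + Z *: ((cmx A + cmx B + cmx C) *m V).
    by rewrite scalemxAl -VE mulmxBl mul1mx subrK.
  by rewrite -map_fps_eval0 map_mxD map_mx1 map_fps_eval0 coefmxX0 addr0.
have algV : mx_algebraic V.
  apply: mx_algebraicV VE _.
  apply: mx_algebraicD; first exact: mx_algebraic1.
  apply/mx_algebraicN/mx_algebraicX.
  by do 2?[apply: mx_algebraicD]; apply: mx_algebraic_cmx.
have algT : mx_algebraic T.
  apply: (@mx_algebraic_quadratic T (c *m V) ((b + c + c - 1%:M) *m V)).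
  - by apply: mx_algebraicM; [apply/mx_algebraicX/mx_algebraic_cmx|].
  - apply: mx_algebraicM => //.
    apply: mx_algebraicD; last exact/mx_algebraicN/mx_algebraic1.
    by do 2?[apply: mx_algebraicD]; apply/mx_algebraicX/mx_algebraic_cmx.
  - by rewrite TT mulmxDl mulmxA.
  - exact: T0.
  - rewrite /b /c -map_fps_eval0 map_mxM map_mxB 2!map_mxD !map_fps_eval0.
    rewrite !coefmxX0 V0 -map_fps_eval0 map_mx1 mulmx1 !addr0 sub0r.
    by rewrite -[RHS]scalemx1 scaleN1r.
have algUN : mx_algebraic (1%:M - U).
  by apply: mx_algebraicV T'U _; rewrite -[T']opprK; apply: mx_algebraicN.
rewrite -[U](subKr 1%:M).
by apply: mx_algebraicD; [exact: mx_algebraic1|apply: mx_algebraicN].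
Qed.

End QuadraticEquation.

(** * The first column of the powers of W, and the algebraicity of G(W) *)

Theorem theoremI (F : fieldType) (s : nat) (hs : (1 <= s)%N)
    (W : imatrix 'M[F]_s)
    (hband : tridiagonal W)
    (hdiag : forall i j : nat, ~ (i = 0%N /\ j = 0%N) -> W i.+1 j.+1 = W i j) :
  forall p q : 'I_s, fps_algebraic (fps_mx (gen_series W) p q).
Proof.
case: s hs W hband hdiag => // n _ W hband hdiag.
have W_sub i : W i.+1 i = W 1%N 0%N by elim: i => // i IH; rewrite hdiag //; case.
have W_sup i : W i i.+1 = W 0%N 1%N by elim: i => // i IH; rewrite hdiag //; case.
have W_diag i : W i.+1 i.+1 = W 1%N 1%N by elim: i => // i IH; rewrite hdiag //; case.
have W_far i j : (j.+1 < i)%N -> W i j = 0.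
  by move=> ji; apply: hband; rewrite !inE; lia.
pose Z := fpsX F.
(* Transposing moves the coefficients to the right of the powers of the unknown. The entry below the
   diagonal becomes the constant term and the one above it the quadratic coefficient. *)
have [U UE algU] := ex_algebraic_quadratic_fixpoint
  (W 1%N 0%N)^T (W 1%N 1%N)^T (W 0%N 1%N)^T.
pose R := U^T.
have RE : R = Z *: (cmx (W 1%N 0%N) + cmx (W 1%N 1%N) *m R
    + cmx (W 0%N 1%N) *m R *m R).
  rewrite /R {1}UE linearZ /= !linearD /= !trmx_mul /cmx !map_trmx !trmxK.
  by rewrite !mulmxA.
have algR : mx_algebraic R by apply: mx_algebraic_tr.
have [G GE] := unitmx_1BfpsX (cmx (W 0%N 0%N) + cmx (W 0%N 1%N) *m R).
have algG : mx_algebraic G.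
  apply: mx_algebraicV GE _; apply: mx_algebraicD; first exact: mx_algebraic1.
  apply/mx_algebraicN/mx_algebraicX/mx_algebraicD; first exact: mx_algebraic_cmx.
  by apply: mx_algebraicM => //; apply: mx_algebraic_cmx.
(* The first columns of the powers of W have a generating series [h] determined by
   [h = e_0 + z W h]. The column of the [R^i G] satisfies this too: row 0 by the choice of [G], the
   other rows by [RE]. *)
pose H i := iter i (mulmx R) G.
have H0 : H 0%N =
    1%:M + Z *: (cmx (W 0%N 0%N) *m H 0%N + cmx (W 0%N 1%N) *m H 1%N).
  by rewrite /H /= mulmxA -mulmxDl scalemxAl -GE mulmxBl mul1mx subrK.
have HS i : H i.+1 = Z *: (cmx (W 1%N 0%N) *m H i + cmx (W 1%N 1%N) *m H i.+1
    + cmx (W 0%N 1%N) *m H i.+2).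
  by rewrite /H /= {1}RE -scalemxAl !mulmxDl !mulmxA.
have HG : H 0%N = G by [].
clearbody H.
have WH l i : imx_exp W l i 0%N = coefmx l (H i).
  elim: l i => [|l IH] i.
    rewrite /imx_exp /imx1 /=; case: i => [|i] /=; last by rewrite HS coefmxX0.
    by rewrite H0 coefmxD coefmxX0 addr0 -map_fps_eval0 map_mx1.
  rewrite /imx_exp iterS -/(imx_exp W l) imx_mul_tridiagonal //.
  under eq_bigr do rewrite IH.
  case: i => [|i].
    rewrite !big_ord_recr big_ord0 /= add0r [in RHS]H0 coefmxD coefmxXS coefmxD !coefmxCM.
    by rewrite -[1%:M](@map_mx1 _ _ (@poly_fps F \o polyC)) coefmx_cmx add0r.
  (* Row [i.+1] meets the band in columns [i], [i.+1] and [i.+2]; the terms with [k < i] vanish. *)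
  rewrite 3!big_ord_recr /= big1 ?add0r => [|k _]; last first.
    by rewrite W_far ?mul0r //= !ltnS.
  by rewrite [in RHS]HS coefmxXS !coefmxD !coefmxCM W_sub W_diag W_sup.
have -> : fps_mx (gen_series W) = G.
  apply/matrixP => p q; rewrite mxE; apply/fpsP => l /=.
  by rewrite WH HG mxE.
exact/mx_algebraicP.
Qed.
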